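(* Fix $\rho>0$ satisfying $H(\rho)+\rho<1$. There are constants $d_0, C_1, C_1', C_2>0$, all depending on $\rho$, such that if $\Sigma$ is a $d$-regular bipartite graph on $N$ vertices with bipartite expansion $\delta$ and locality $\ell$ satisfying $$\delta \geq \max\left\{\frac{C_1\log^3 d}{d},\frac{C_1'\log d}{\ell}\right\}$$ and with $d\geq d_0$, then $$|\mathcal{C}_3^{b,\rho,0}(\Sigma)| \leq \exp_2\left\{\frac{N}{2}\left(1-\frac{C_2\delta}{\log d}\right)\right\}.$$
   Context: All graphs are finite, simple and loopless. $\log=\log_2$, $\exp_2 x=2^x$, and $H(x)=-x\log x-(1-x)\log(1-x)$ is the binary entropy function on $[0,1]$ (with $0\log 0=0$). Let $\Sigma=(V,E)$ be a $d$-regular bipartite graph with partition classes $\mathcal{E}$ and $\mathcal{O}$. For $u,v\in V$ write $u\sim v$ if $u,v$ are adjacent; $N(u)=\{w\in V: w\sim u\}$ and $N(A)=\bigcup_{w\in A}N(w)$ for $A\subseteq V$. For $A\subseteq\mathcal{E}$ (or $A\subseteq\mathcal{O}$) set $[A]=\{x\in V: N(x)\subseteq N(A)\}$, and call $A$ small if $|[A]|\leq |V|/4$. The bipartite expansion of $\Sigma$ is $$\delta(\Sigma)=\min\left\{\frac{|N(A)|-|[A]|}{|N(A)|}: A\subseteq\mathcal{E}\ (\text{or } A\subseteq\mathcal{O}),\ A \text{ small},\ A\neq\emptyset\right\}.$$ The locality $\ell(\Sigma)$ is the largest $\ell\geq 0$ such that for all adjacent $x\sim y$ in $V$ and all independent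 sets $I$ in the subgraph of $\Sigma$ induced by $N(x)\cup N(y)$ we have $|I|\leq 2d-\ell$. $\mathcal{C}_3=\mathcal{C}_3(\Sigma)$ is the set of proper $3$-colourings $\chi:V\to\{0,1,2\}$ of $\Sigma$, and $$\mathcal{C}_3^{b,\rho,0}(\Sigma)=\left\{\chi\in\mathcal{C}_3:\ \bigl||\chi^{-1}(0)\cap\mathcal{E}|-|\chi^{-1}(0)\cap\mathcal{O}|\bigr|\leq \rho N/2\right\}.$$ *)

(* Defs.v *)
From mathcomp Require Import all_boot all_order all_algebra.
From mathcomp Require Import reals exp.

Set Implicit Arguments.
Unset Strict Implicit.
Unset Printing Implicit Defensive.

Import Order.TTheory GRing.Theory Num.Theory.

Local Open Scope ring_scope.

Section Logarithms.
Variable R : realType.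

Definition log2 (x : R) : R := ln x / ln 2.

Definition exp2 (x : R) : R := 2 `^ x.

(* Meant for 0 <= x <= 1 only; the convention 0 log 0 = 0 is [mul0r]. *)
Definition binary_entropy (x : R) : R :=
  - x * log2 x - (1 - x) * log2 (1 - x).

End Logarithms.

Section Graphs.
Variables (V : finType) (adj : rel V).

Definition neighbours (u : V) : {set V} := [set w | adj u w].

Definition simple_graph : Prop := symmetric adj /\ irreflexive adj.

Definition regular (d : nat) : Prop := forall u, #|neighbours u| = d.

Definition bipartition (E O : {set V}) : Prop :=
  [/\ E :|: O = [set: V],
      [disjoint E & O] &
      forall u v, adj u v ->
        (u \in E) && (v \in O) || (u \in O) && (v \in E)].

Definition neighbourhood (A : {set V}) : {set V} :=
  \bigcup_(w in A) neighbours w.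

Definition bclosure (A : {set V}) : {set V} :=
  [set x | neighbours x \subset neighbourhood A].

Definition small (A : {set V}) : bool := (4 * #|bclosure A| <= #|V|)%N.

Definition one_sided (E O A : {set V}) : bool :=
  (A \subset E) || (A \subset O).

Definition expansion_ratio (R : realType) (A : {set V}) : R :=
  (#|neighbourhood A|%:R - #|bclosure A|%:R) / #|neighbourhood A|%:R.

(* [delta] is the minimum defining the bipartite expansion. A graph without
   nonempty small one-sided set (such as K_{d,d}) has no such [delta]. *)
Definition is_bipartite_expansion (R : realType) (E O : {set V}) (delta : R)
    : Prop :=
  (exists A : {set V},
     [/\ one_sided E O A, small A, A != set0 & delta = expansion_ratio R A]) /\
  (forall A : {set V}, one_sided E O A -> small A -> A != set0 ->
     delta <= expansion_ratio R A).

Definition independent (I : {set V}) : Prop :=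
  {in I &, forall u v, ~~ adj u v}.

(* |I| <= 2d - l, written without truncated subtraction. *)
Definition locality_bound (d l : nat) : Prop :=
  forall x y, adj x y ->
  forall I : {set V}, I \subset neighbours x :|: neighbours y ->
    independent I -> (#|I| + l <= 2 * d)%N.

Definition is_locality (d l : nat) : Prop :=
  locality_bound d l /\ (forall l', locality_bound d l' -> (l' <= l)%N).

Definition proper_colourings : {set {ffun V -> 'I_3}} :=
  [set chi : {ffun V -> 'I_3} | [forall u, forall v, adj u v ==> (chi u != chi v)]].

Definition colour_class (chi : {ffun V -> 'I_3}) (c : 'I_3) : {set V} :=
  [set v | chi v == c].

Definition balanced_colourings (R : realType) (E O : {set V}) (rho : R)
    : {set {ffun V -> 'I_3}} :=
  [set chi in proper_colourings |
    `| #|colour_class chi ord0 :&: E|%:R - #|colour_class chi ord0 :&: O|%:R |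
      <= rho * #|V|%:R / 2].

End Graphs.

(* Main.v *)
(* Reveal vertices of a proper colouring greedily, as long as a new vertex shows
   a new colour to d/20 of its neighbours; every vertex sees at most two colours,
   so only 40 |V| / d vertices are revealed, at a cost of O(|V| log d / d) bits.
   Afterwards a vertex that sees two revealed colours is determined, and so is a
   vertex v with at least d/10 neighbours seeing at most one colour, as most of
   these see exactly the colour of v. The set W of unresolved vertices therefore
   induces a graph of maximum degree less than d/10. Colour the ends of a maximal
   matching of W: each of its edges costs only log 3 bits, whereas its two ends
   lower the bound |V|/2 on the number of remaining vertices by about 1.8.
   The vertices F that are still free form an independent set, each has a
   monochromatic neighbourhood, and the pieces of F by side and colour have
   disjoint neighbourhoods outside F. If every piece is small, expansion makes F
   smaller than |V|/2 by a factor 1 - c delta. Otherwise a unique piece is not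
   small, and the same gain is made unless it fills almost one side; then the
   other side is almost entirely of one colour, and the balance condition forces
   colour 0 to be used on at most about a fraction rho of the piece. *)
Require Import Defs.
From mathcomp Require Import all_boot all_order all_algebra.
From mathcomp Require Import reals exp.
From mathcomp Require Import zify ring lra.

Set Implicit Arguments.
Unset Strict Implicit.
Unset Printing Implicit Defensive.

Import Order.TTheory GRing.Theory Num.Theory.

Local Open Scope ring_scope.

(** * Base-two exponentials, logarithms and entropy *)

Section Exp2.
Variable R : realType.
Implicit Types x y : R.

Lemma ln2_gt0 : 0 < ln (2 : R).
Proof. by rewrite ln_gt0 // ltr1n. Qed.

Lemma exp2_gt0 x : 0 < exp2 x.
Proof. by rewrite /exp2 powR_gt0. Qed.

Lemma exp2D x y : exp2 (x + y) = exp2 x * exp2 y.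
Proof. by rewrite /exp2 powRD // pnatr_eq0 implybT. Qed.

Lemma exp2_nat n : exp2 (n%:R : R) = 2 ^+ n.
Proof. by rewrite /exp2 powR_mulrn. Qed.

Lemma exp2Mn x n : exp2 (x * n%:R) = exp2 x ^+ n.
Proof. by rewrite /exp2 powRrM powR_mulrn // powR_ge0. Qed.

Lemma ler_exp2 x y : x <= y -> exp2 x <= exp2 y.
Proof. by move=> xy; rewrite /exp2 ler_powR // ler1n. Qed.

Lemma exp2_log2 x : 0 < x -> exp2 (log2 x) = x.
Proof.
move=> x_gt0; rewrite /exp2 /powR pnatr_eq0 /= /log2 mulfVK ?lnK //.
by rewrite gt_eqF // ln2_gt0.
Qed.

Lemma log2_ge0 x : 1 <= x -> 0 <= log2 x.
Proof. by move=> x1; rewrite /log2 divr_ge0 ?ln_ge0 ?ler1n. Qed.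

Lemma log2_le0 x : x <= 1 -> log2 x <= 0.
Proof. by move=> x1; rewrite /log2 pmulr_lle0 ?ln_le0 // invr_gt0 ln2_gt0. Qed.

Lemma log2_ge1 x : 2 <= x -> 1 <= log2 x.
Proof.
move=> x2; rewrite /log2 ler_pdivlMr ?ln2_gt0 // mul1r.
by rewrite ler_ln ?posrE //; lra.
Qed.

Lemma log2M x y : 0 < x -> 0 < y -> log2 (x * y) = log2 x + log2 y.
Proof. by move=> x0 y0; rewrite /log2 lnM ?posrE // mulrDl. Qed.

Lemma log2V x : 0 < x -> log2 x^-1 = - log2 x.
Proof. by move=> x0; rewrite /log2 lnV ?posrE // mulNr. Qed.

Lemma log2_le_N1 x : 0 < x -> x <= 2^-1 -> log2 x <= -1.
Proof.
move=> x0 x2; have := @log2_ge1 x^-1.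
by rewrite log2V // -[leLHS]invrK lef_pV2 ?posrE ?invr_gt0 // => /(_ x2); lra.
Qed.

(** For [rho] at least 1/2 the logarithm of 1 - rho is at most -1, so the second entropy term alone
    reaches 1 - rho. The bound serves to make the odds (1 - rho) / rho at least 1. *)
Lemma binary_entropy_lt_half (rho : R) :
  0 < rho -> rho <= 1 -> binary_entropy rho + rho < 1 -> rho < 2^-1.
Proof.
move=> rho0 rho1 H; case: (ltP rho 2^-1) => // rho2.
have log_rho := log2_le0 rho1.
have [rho_lt1|rho_ge1] := ltP rho 1.
  have : log2 (1 - rho) <= -1 by apply: log2_le_N1; lra.
  by move: H; rewrite /binary_entropy; nra.
(* At rho = 1 the factor 1 - rho annihilates the term containing [log2 0]. *)
by move: H; rewrite /binary_entropy (_ : 1 - rho = 0); [nra|lra].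
Qed.

(* 1 / ln 2 <= 2 *)
Lemma exp2_ge1D x : 0 <= x -> 1 + x <= exp2 (2 * x).
Proof.
move=> x0; rewrite /exp2 /powR pnatr_eq0 /=.
apply: le_trans (expR_ge1Dx x) _; rewrite ler_expR.
have : 1 <= 2 * ln (2 : R); last by nra.
have := @le_ln1Dx R (- 2^-1); rewrite (_ : 1 - 2^-1 = 2^-1); last by lra.
by rewrite lnV ?posrE // => /(_ _); lra.
Qed.

End Exp2.

(** * Weighted counts of list colourings and partial colourings *)

Section Counting.
Variables (R : numDomainType) (V : finType).
Local Notation colouring := {ffun V -> 'I_3}.

(* Giving a non-constant weight to the choices turns this into a Chernoff-type
   bound for the number of colourings with few vertices of a given colour. *)
Lemma weighted_list_colourings (F : {set V}) (m : V -> 'I_3) (chi0 : colouring)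
    (wt : V -> 'I_3 -> R) (Y : {set colouring}) :
  (forall v c, 0 <= wt v c) ->
  (forall chi, chi \in Y ->
     (forall v, v \notin F -> chi v = chi0 v) /\
     (forall v, v \in F -> chi v != m v)) ->
  \sum_(chi in Y) \prod_(v in F) wt v (chi v)
    <= \prod_(v in F) \sum_(c | c != m v) wt v c.
Proof.
move=> wt_ge0 HY.
(* Outside [F] the list is the single colour [chi0 v] with weight 1, so that a product over all of
   [V] can be expanded into a sum over total colourings. *)
pose Q v c := if v \in F then c != m v else c == chi0 v.
pose w v c := if v \in F then wt v c else 1.
have -> : \prod_(v in F) \sum_(c | c != m v) wt v c
        = \prod_v \sum_(c | Q v c) w v c.
  rewrite [RHS](bigID (mem F)) /= [X in _ * X]big1 ?mulr1.
    by apply: eq_bigr => v vF; rewrite /Q /w vF.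
  by move=> v /negbTE vF; rewrite /Q /w vF big_pred1_eq.
rewrite bigA_distr_big_dep /=.
have Ew (chi : colouring) : \prod_v w v (chi v) = \prod_(v in F) wt v (chi v).
  rewrite (bigID (mem F)) /= [X in _ * X]big1 ?mulr1.
    by apply: eq_bigr => v vF; rewrite /w vF.
  by move=> v /negbTE vF; rewrite /w vF.
rewrite (eq_bigr _ (fun chi _ => Ew chi)).
rewrite [leRHS](bigID (mem Y)) /= ler_wpDr //.
  by apply: sumr_ge0 => chi _; apply: prodr_ge0 => v _.
rewrite le_eqVlt; apply/orP; left; apply/eqP.
apply: eq_bigl => chi; apply/idP/andP => [chiY|[] //].
split=> //; apply/familyP => v; rewrite unfold_in /Q.
by have [Hout Hin] := HY _ chiY; case: ifPn => [/Hin //|/Hout ->].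
Qed.

Lemma card_neq_colour (c : 'I_3) : #|[pred c' | c' != c]| = 2.
Proof. by have := cardC1 c; rewrite card_ord. Qed.

Lemma card_list_colourings (F : {set V}) (m : V -> 'I_3) (chi0 : colouring)
    (Y : {set colouring}) :
  (forall chi, chi \in Y ->
     (forall v, v \notin F -> chi v = chi0 v) /\
     (forall v, v \in F -> chi v != m v)) ->
  #|Y|%:R <= 2 ^+ #|F| :> R.
Proof.
move=> HY; have := @weighted_list_colourings F m chi0 (fun _ _ => 1) Y.
move=> /(_ (fun _ _ => ler01) HY).
rewrite [leLHS](eq_bigr (fun=> 1)) => [|chi _]; last by rewrite prodr_const expr1n.
rewrite sumr_const [leRHS](eq_bigr (fun=> 2)) ?prodr_const // => v _.
by rewrite sumr_const card_neq_colour.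
Qed.

(** Each vertex contributes 1 if uncoloured and [y] for each of three colours. Taken at y = 1/d,
    this generating function bounds the number of partial colourings with small support. *)
Lemma weighted_partial_colourings (y : R) :
  \sum_(g : {ffun V -> option 'I_3}) y ^+ #|[set v | g v]|
    = (1 + 3 * y) ^+ #|V|.
Proof.
have -> : (1 + 3 * y) ^+ #|V|
  = \prod_(v : V) \sum_(o : option 'I_3) (if o then y else 1).
  rewrite -prodr_const; apply: eq_bigr => v _.
  rewrite (bigD1 None) //=; congr (_ + _).
  rewrite (reindex_omap Some id) /=; last by case.
  rewrite (eq_bigl xpredT) => [|c]; last by rewrite eqxx.
  by rewrite sumr_const card_ord mulr_natl.
rewrite bigA_distr_bigA /=; apply: eq_bigr => g _.
rewrite -prodr_const big_mkcond /=; apply: eq_bigr => v _.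
by rewrite inE.
Qed.

End Counting.

Lemma leq_card_bigcup (I T : finType) (P : pred I) (A : I -> {set T}) :
  (#|\bigcup_(i | P i) A i| <= \sum_(i | P i) #|A i|)%N.
Proof.
elim/big_rec2: _ => [|i n B _ le_n]; first by rewrite cards0.
by apply: leq_trans (leq_card_setU _ _) _; rewrite leq_add2l.
Qed.

Lemma card_avoiding (p A : {set 'I_3}) :
  A \subset ~: p -> (#|p| + #|A| <= 3)%N.
Proof.
move=> /subset_leq_card Ap; apply: (@leq_trans (#|p| + #|~: p|)).
  by rewrite leq_add2l.
by rewrite cardsC card_ord.
Qed.

(** * Double counting in a regular graph *)

Section RegularGraph.
Variables (V : finType) (adj : rel V) (d : nat).
Hypotheses (adj_sym : symmetric adj) (adj_reg : regular adj d) (d_gt0 : (0 < d)%N).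
Local Notation N := (neighbours adj).
Local Notation NN := (neighbourhood adj).
Local Notation colouring := {ffun V -> 'I_3}.

Lemma in_neighbours u w : (w \in N u) = adj u w.
Proof. by rewrite inE. Qed.

Lemma neighbourhoodP (A : {set V}) y :
  reflect (exists2 a, a \in A & adj a y) (y \in NN A).
Proof.
apply: (iffP bigcupP) => -[a aA]; first by rewrite in_neighbours; exists a.
by move=> ay; exists a; rewrite ?in_neighbours.
Qed.

Lemma proper_colour_neq chi u v :
  chi \in proper_colourings adj -> adj u v -> chi u != chi v.
Proof. by rewrite inE => /forallP/(_ u)/forallP/(_ v)/implyP. Qed.

Lemma edge_count (A B : {set V}) :
  (\sum_(a in A) #|N a :&: B| = \sum_(b in B) #|N b :&: A|)%N.
Proof.
have E (C : {set V}) c : (#|N c :&: C| = \sum_(b in C) adj c b)%N.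
  rewrite -sum1_card [LHS]big_mkcond [RHS]big_mkcond /=; apply: eq_bigr => b _.
  by rewrite inE in_neighbours; case: (b \in C); case: (adj c b).
rewrite (eq_bigr _ (fun a _ => E B a)) exchange_big /=.
by apply: eq_bigr => b _; rewrite E; apply: eq_bigr => a _; rewrite adj_sym.
Qed.

(** Every vertex of [A] sends d edges into [B], and every vertex of [B] receives at most d. *)
Lemma leq_card_neighbours (A B : {set V}) :
  (forall a, a \in A -> N a \subset B) -> (#|A| <= #|B|)%N.
Proof.
move=> AB; rewrite -(leq_pmul2r d_gt0).
have -> : (#|A| * d = \sum_(a in A) #|N a :&: B|)%N.
  rewrite -sum_nat_const; apply: eq_bigr => a /AB aB.
  by rewrite (setIidPl aB) adj_reg.
rewrite edge_count -sum_nat_const; apply: leq_sum => b _.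
by rewrite -(adj_reg b) subset_leq_card // subsetIl.
Qed.

Lemma sub_neighbourhood (A : {set V}) a : a \in A -> N a \subset NN A.
Proof. exact: (bigcup_sup a). Qed.

Lemma leq_card_neighbourhood (A : {set V}) : (#|A| <= #|NN A|)%N.
Proof. by apply: leq_card_neighbours => a; apply: sub_neighbourhood. Qed.

Lemma leq_card_bclosure (A : {set V}) : (#|bclosure adj A| <= #|NN A|)%N.
Proof. by apply: leq_card_neighbours => a; rewrite inE. Qed.

Lemma subset_bclosure (A : {set V}) : A \subset bclosure adj A.
Proof. by apply/subsetP => a aA; rewrite inE sub_neighbourhood. Qed.

Lemma exists_neighbour v : exists y, adj v y.
Proof.
have /card_gt0P[y] : (0 < #|N v|)%N by rewrite adj_reg.
by rewrite in_neighbours; exists y.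
Qed.

(** Every edge inside [W] meets [T], so the degrees inside [W] sum to at most twice those of [T],
    hence to at most d |T| / 5. The edges leaving [W] number at most d (|V| - |W|). Together these
    account for all d |W| edge ends. *)
Lemma sparse_cover_bound (W T : {set V}) :
  T \subset W ->
  {in W :\: T &, forall u w, ~~ adj u w} ->
  {in W, forall w, (10 * #|N w :&: W| <= d)%N} ->
  (10 * #|W| <= 5 * #|V| + #|T|)%N.
Proof.
move=> TW indep sparse.
pose s := (\sum_(t in T) #|N t :&: W|)%N.
have s_le : (10 * s <= #|T| * d)%N.
  rewrite -sum_nat_const big_distrr /=; apply: leq_sum => t tT.
  exact/sparse/(subsetP TW).
have eW : (\sum_(w in W) #|N w :&: W| <= 2 * s)%N.
  rewrite (big_setID T) /= (setIidPr TW) mul2n -addnn leq_add2l.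
  rewrite (eq_bigr (fun w => #|N w :&: T|)); last first.
    move=> w wWT; apply: eq_card => y; rewrite !inE.
    case wy: (adj w y) => //=; apply/idP/idP; last exact/subsetP.
    move=> yW; apply: contraT => yT.
    by have := indep w y wWT; rewrite inE yT yW wy => /(_ isT).
  rewrite edge_count; apply: leq_sum => t _.
  by apply/subset_leq_card/setIS/subsetDl.
have eC : (\sum_(w in W) #|N w :&: ~: W| <= #|~: W| * d)%N.
  rewrite edge_count -sum_nat_const; apply: leq_sum => b _.
  by rewrite -(adj_reg b) subset_leq_card // subsetIl.
have eWd : (#|W| * d = \sum_(w in W) #|N w :&: W| + \sum_(w in W) #|N w :&: ~: W|)%N.
  rewrite -big_split -sum_nat_const; apply: eq_bigr => w _ /=.
  by rewrite -(adj_reg w) -(cardsID W (N w)) setDE.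
have cW := cardsC W.
suff : (20 * #|W| * d <= (10 * #|V| + 2 * #|T|) * d)%N.
  by rewrite leq_pmul2r //; lia.
by rewrite -cW; nia.
Qed.

(** * Greedy revelation of a colouring *)

Definition palette (g : {ffun V -> option 'I_3}) (v : V) : {set 'I_3} :=
  [set c | [exists u, adj v u && (g u == Some c)]].

Definition light (g : {ffun V -> option 'I_3}) : {set V} :=
  [set v | #|palette g v| <= 1]%N.

Definition extends (chi : colouring) (g : {ffun V -> option 'I_3}) : bool :=
  [forall u, (g u == None) || (g u == Some (chi u))].

(** These are the light vertices whose palette would grow if [u] were revealed. *)
Definition missed (chi : colouring) (g : {ffun V -> option 'I_3}) (u : V)
    : {set V} :=
  [set y in N u :&: light g | chi u \notin palette g y].

Definition saturated (chi : colouring) (g : {ffun V -> option 'I_3}) : bool :=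
  [forall u, 20 * #|missed chi g u| < d]%N.

Lemma proper_notin_palette chi g v :
  chi \in proper_colourings adj -> extends chi g -> chi v \notin palette g v.
Proof.
move=> chiP /forallP ext; rewrite inE; apply/existsP => -[u /andP[vu gu]].
have := ext u; rewrite (eqP gu) /= => /eqP[] e.
by have := proper_colour_neq chiP vu; rewrite e eqxx.
Qed.

Lemma card_palette chi g v :
  chi \in proper_colourings adj -> extends chi g -> (#|palette g v| <= 2)%N.
Proof.
move=> chiP ext.
have : [set chi v] \subset ~: palette g v.
  by rewrite sub1set inE proper_notin_palette.
by move=> /card_avoiding; rewrite cards1 addn1.
Qed.

(* Greedy choice: revealing a vertex that is not yet saturated adds a colour to
   d/20 palettes, each of which can grow only twice. *)
Lemma exists_saturated chi :
  chi \in proper_colourings adj ->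
  exists g, [/\ extends chi g, saturated chi g &
                d * #|[set v | g v]| <= 40 * #|V|]%N.
Proof.
move=> chiP.
pose g (S : {set V}) := [ffun v => if v \in S then Some (chi v) else None].
have ext S : extends chi (g S).
  by apply/forallP => u; rewrite ffunE; case: ifP; rewrite eqxx ?orbT.
(* Invariant: the revealed vertices have paid for themselves with d/20 palette entries each, on
   average. A maximal [S] with this property is saturated. *)
pose Q (S : {set V}) := (d * #|S| <= 20 * \sum_y #|palette (g S) y|)%N.
have Q0 : Q set0 by rewrite /Q cards0 muln0.
have [S /maxsetP[QS maxS]] := ex_maxset (ex_intro Q set0 Q0).
have suppS : [set v | g S v] = S.
  by apply/setP => v; rewrite inE ffunE; case: (v \in S).
exists (g S); split=> //; last first.
  rewrite suppS; apply: leq_trans QS _.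
  suff : (\sum_y #|palette (g S) y| <= #|V| * 2)%N by lia.
  rewrite -sum_nat_const; apply: leq_sum => y _.
  exact: card_palette chiP (ext S).
apply/forallP => u; rewrite ltnNge; apply/negP => bad.
have [y] : exists y, y \in missed chi (g S) u.
  by apply/card_gt0P; move: bad d_gt0; lia.
rewrite !inE => /andP[/andP[uy _]] /existsP nuy.
(* Had [u] been revealed, its neighbour [y] would already see its colour. *)
have uS : u \notin S.
  apply: contra_notN nuy => uS; exists u.
  by rewrite adj_sym uy ffunE uS eqxx.
suff QuS : Q (u |: S).
  by move: uS; rewrite -(maxS _ QuS) ?subsetUr // setU11.
clear y uy nuy.
have grow y : (#|palette (g S) y| + (y \in missed chi (g S) u)
                 <= #|palette (g (u |: S)) y|)%N.
  have sub : palette (g S) y \subset palette (g (u |: S)) y.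
    apply/subsetP => c; rewrite !inE => /existsP[w /andP[yw]].
    rewrite ffunE; case: ifP => // wS /eqP[<-].
    by apply/existsP; exists w; rewrite yw ffunE !inE wS orbT eqxx.
  have [|_] := boolP (y \in missed chi (g S) u); last first.
    by rewrite addn0 subset_leq_card.
  rewrite addn1 inE => /andP[]; rewrite !inE => /andP[uy _] nuy.
  apply/proper_card; rewrite properE sub; apply/subsetPn; exists (chi u).
    rewrite inE; apply/existsP; exists u.
    by rewrite adj_sym uy ffunE !inE eqxx /=.
  by rewrite inE.
have : (\sum_y #|palette (g S) y| + #|missed chi (g S) u|
          <= \sum_y #|palette (g (u |: S)) y|)%N.
  rewrite -sum1_card [X in (_ + X <= _)%N]big_mkcond -big_split; apply: leq_sum => y _.
  exact: grow.
by move: QS; rewrite /Q cardsU1 uS; lia.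
Qed.

Definition unresolved (g : {ffun V -> option 'I_3}) : {set V} :=
  [set v in light g | 10 * #|N v :&: light g| < d]%N.

(** If the two colourings differ at [v], the palette of [v] avoids two colours, so [v] is light. A
    light neighbour cannot see both colours, so one of the colourings misses it; each misses fewer
    than d/20, which leaves [v] with fewer than d/10 light neighbours. *)
Lemma eq_off_unresolved chi chi' g v :
  chi \in proper_colourings adj -> extends chi g -> saturated chi g ->
  chi' \in proper_colourings adj -> extends chi' g -> saturated chi' g ->
  v \notin unresolved g -> chi v = chi' v.
Proof.
move=> P1 E1 S1 P2 E2 S2; apply: contraNeq => neq; rewrite !inE.
have pair (p : {set 'I_3}) : (chi v \notin p) -> (chi' v \notin p) -> (#|p| <= 1)%N.
  move=> n1 n2; have : [set chi v; chi' v] \subset ~: p.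
    by apply/subsetP => c; rewrite !inE => /orP[]/eqP->.
  by move/card_avoiding; rewrite cards2 neq addn2.
rewrite pair ?proper_notin_palette //= ltnNge; apply/negP => dle.
move/forallP/(_ v): S1; move/forallP/(_ v): S2.
suff : (#|N v :&: light g| <= #|missed chi g v| + #|missed chi' g v|)%N by lia.
apply: leq_trans (leq_card_setU _ _).
apply/subset_leq_card/subsetP => y yl; rewrite in_setU.
rewrite ![y \in missed _ _ _]in_set yl /=.
move: yl; rewrite in_setI => /andP[_]; rewrite in_set => pal.
rewrite -negb_and.
apply/negP => /andP[c1 c2].
have /subset_leq_card : [set chi v; chi' v] \subset palette g y.
  by apply/subsetP => c; rewrite in_set2 => /orP[]/eqP->.
by rewrite cards2 neq ltnNge pal.
Qed.

End RegularGraph.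

(** * The two sides of the bipartition and their expansion *)

Section Expansion.
Variables (R : realType) (V : finType) (adj : rel V) (E O : {set V}) (d : nat).
Variables (rho delta : R).
Hypotheses (adj_sym : symmetric adj) (adj_reg : regular adj d) (d_gt0 : (0 < d)%N).
Hypothesis EO_bip : bipartition adj E O.
Hypotheses (rho_gt0 : 0 < rho) (rho_lt2 : rho < 2^-1).
Hypothesis H_rho : binary_entropy rho + rho < 1.
Hypotheses (delta_ge0 : 0 <= delta) (delta_le1 : delta <= 1).
Hypothesis expansion : forall A : {set V}, one_sided E O A -> small adj A ->
  A != set0 -> delta <= expansion_ratio adj R A.
Local Notation N := (neighbours adj).
Local Notation NN := (neighbourhood adj).
Local Notation colouring := {ffun V -> 'I_3}.

(** Indexing the classes by a boolean lets arguments symmetric in [E] and [O] be made once. *)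
Definition side (s : bool) : {set V} := [set v | (v \in E) == s].

Lemma sideT : side true = E.
Proof. by apply/setP => v; rewrite inE eqb_id. Qed.

Lemma sideF : side false = O.
Proof.
case: EO_bip => EO /disjoint_setI0 dis _; apply/setP => v; rewrite inE eqbF_neg.
move/setP/(_ v): EO; move/setP/(_ v): dis; rewrite !inE.
by case: (v \in E); case: (v \in O).
Qed.

Lemma side_neg s v : (v \in side (~~ s)) = (v \notin side s).
Proof. by rewrite !inE; case: s; case: (v \in E). Qed.

Lemma side_adj s u v : adj u v -> (v \in side (~~ s)) = (u \in side s).
Proof.
case: EO_bip => _ _ H /H; rewrite -!sideT -!sideF !inE.
by case: s; case: (u \in E); case: (v \in E).
Qed.

Lemma one_sided_side s (A : {set V}) : A \subset side s -> one_sided E O A.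
Proof.
by rewrite /one_sided -sideT -sideF; case: s => ->; rewrite ?orbT.
Qed.

Lemma neighbourhood_side s (A : {set V}) :
  A \subset side s -> NN A \subset side (~~ s).
Proof.
move=> As; apply/subsetP => y /neighbourhoodP[a /(subsetP As) aA ay].
by rewrite (side_adj s ay).
Qed.

Lemma bclosure_side s (A : {set V}) :
  A \subset side s -> bclosure adj A \subset side s.
Proof.
move=> As; apply/subsetP => x; rewrite inE => xA.
have [y xy] := exists_neighbour adj_reg d_gt0 x; rewrite -(side_adj s xy).
apply: (subsetP (neighbourhood_side As)); apply: (subsetP xA).
by rewrite in_neighbours.
Qed.

Lemma card_side s : (2 * #|side s| = #|V|)%N.
Proof.
have le t : (#|side t| <= #|side (~~ t)|)%N.
  apply: (leq_card_neighbours adj_sym adj_reg d_gt0) => a aE.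
  by apply/subsetP => y; rewrite in_neighbours => ay; rewrite (side_adj t ay).
have e : (#|side s| = #|side (~~ s)|)%N.
  by apply/eqP; rewrite eqn_leq le -{2}(negbK s) le.
rewrite -(cardsC (side s)) mul2n -addnn {2}e; congr addn; apply: eq_card => v.
by rewrite side_neg in_setC.
Qed.

Lemma card_sideR s : #|side s|%:R = #|V|%:R / 2 :> R.
Proof. by have := congr1 (fun n => n%:R : R) (card_side s); rewrite natrM; lra. Qed.

(** Expansion cleared of its denominator and weakened by |A| <= |[A]|, in a form that also covers
    the empty set and can be summed over pieces. *)
Lemma small_gap s (A : {set V}) : A \subset side s -> small adj A ->
  delta * #|NN A|%:R + #|A|%:R <= #|NN A|%:R.
Proof.
move=> As smA; have [->|A0] := eqVneq A set0.
  by rewrite /neighbourhood big_set0 !cards0; lra.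
have := expansion (one_sided_side As) smA A0; rewrite /expansion_ratio.
have NA0 : 0 < (#|NN A|%:R : R).
  rewrite ltr0n; apply: leq_trans (leq_card_neighbourhood adj_sym adj_reg d_gt0 A).
  by rewrite card_gt0.
rewrite ler_pdivlMr // => gap.
have : #|A|%:R <= (#|bclosure adj A|%:R : R).
  by rewrite ler_nat subset_leq_card // subset_bclosure.
by move: gap; lra.
Qed.

(** * Colourings that vary only on an independent set with monochromatic neighbourhoods *)

Section Leaf.
Variables (F : {set V}) (chi0 : colouring) (m : V -> 'I_3).
Hypothesis F_indep : {in F &, forall u v, ~~ adj u v}.
Hypothesis F_mono : forall f y, f \in F -> adj f y -> chi0 y = m f.

Definition piece (i : bool * 'I_3) : {set V} :=
  [set f in F | (f \in side i.1) && (m f == i.2)].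

Lemma piece_side i : piece i \subset side i.1.
Proof. by apply/subsetP => f; rewrite inE => /and3P[]. Qed.

(** The side and colour of [y] determine [i], so distinct pieces have disjoint neighbourhoods, all
    outside [F]. *)
Lemma piece_neighbour i y :
  y \in NN (piece i) -> [/\ y \notin F, y \in side (~~ i.1) & chi0 y = i.2].
Proof.
move=> yi; split; last 2 first.
- exact: subsetP (neighbourhood_side (piece_side i)) _ yi.
- case/neighbourhoodP: yi => f; rewrite inE => /and3P[fF _ /eqP<-].
  exact: F_mono.
case/neighbourhoodP: yi => f; rewrite inE => /and3P[fF _ _] fy.
by apply: contraL fy => yF; apply: F_indep.
Qed.

Lemma sum_card_piece : (\sum_i #|piece i| = #|F|)%N.
Proof.
rewrite -[RHS]sum1_card (partition_big (fun f => (f \in E, m f)) xpredT) //=.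
apply: eq_bigr => -[s c] _; rewrite -sum1_card; apply: eq_bigl => f.
by rewrite !inE xpair_eqE.
Qed.

Lemma sum_card_neighbourhood_piece :
  (#|F| + \sum_i #|NN (piece i)| <= #|V|)%N.
Proof.
rewrite -(cardsC F) leq_add2l -[leqRHS]sum1_card.
rewrite (partition_big (fun f => (f \notin E, chi0 f)) xpredT) //=.
apply: leq_sum => -[s c] _; rewrite sum1dep_card; apply: subset_leq_card.
apply/subsetP => y /piece_neighbour[yF /= ys yc]; rewrite !inE yF xpair_eqE yc eqxx.
by move: ys; rewrite inE; case: (y \in E); case: s.
Qed.

Lemma card_leafR : #|F|%:R <= #|V|%:R / 2 :> R.
Proof.
have := sum_card_neighbourhood_piece; rewrite -{2}sum_card_piece.
have : (\sum_i #|piece i| <= \sum_i #|NN (piece i)|)%N.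
  apply: leq_sum => i _; exact: leq_card_neighbourhood.
rewrite sum_card_piece => h1 h2; have : (2 * #|F| <= #|V|)%N by lia.
by rewrite -(ler_nat R) natrM; lra.
Qed.

(** On the side of piece [i], a set [X] of more than |V|/4 vertices is disjoint from the closure of
    that piece, which leaves less than |V|/4 for it. For pieces on one side, a common vertex of the
    closures would have a neighbour of two colours; for opposite sides, a common vertex would have a
    neighbour in [F]. *)
Lemma other_piece_small i i0 :
  i != i0 -> ~~ small adj (piece i0) -> small adj (piece i).
Proof.
move=> ii0; rewrite /small -ltnNge => big0.
pose X := if i.1 == i0.1 then bclosure adj (piece i0) else NN (piece i0).
have X_le : (#|bclosure adj (piece i0)| <= #|X|)%N.
  by rewrite /X; case: ifP => // _; apply: leq_card_bclosure.
have Xs : X \subset side i.1.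
  rewrite /X; case: eqP => [->|/eqP ne]; first exact/bclosure_side/piece_side.
  have -> : i.1 = ~~ i0.1 by move: ne; case: i.1; case: i0.1.
  exact/neighbourhood_side/piece_side.
have dis : bclosure adj (piece i) :&: X = set0.
  apply/setP => x; rewrite in_setI in_set0; apply/negP => /andP[].
  rewrite inE => /subsetP xi; rewrite /X; case: eqP => [e|_].
    rewrite inE => /subsetP xi0.
    have [y xy] := exists_neighbour adj_reg d_gt0 x.
    rewrite -in_neighbours in xy; case/negP: ii0.
    have [_ _ c] := piece_neighbour (xi _ xy).
    have [_ _ c0] := piece_neighbour (xi0 _ xy).
    by rewrite -pair_eqE /pair_eq e -c -c0 !eqxx.
  move=> /neighbourhoodP[a]; rewrite inE => /and3P[aF _ _] ax.
  have : a \in N x by rewrite in_neighbours adj_sym.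
  by move/xi/piece_neighbour => []; rewrite aF.
have := subset_leq_card (_ : bclosure adj (piece i) :|: X \subset side i.1).
rewrite subUset Xs bclosure_side ?piece_side // => /(_ isT).
by rewrite cardsU dis cards0; have := card_side i.1; lia.
Qed.

(** The tolerance for a piece that almost fills a side, chosen by [eta_mul] so that the errors of
    order [eta] in the entropy estimate total rho |V| / 4, half of what the entropy hypothesis
    gains. *)
Definition eta : R := rho / (4 * (log2 ((1 - rho) / rho) + 1)).

Lemma odds_ge1 : 1 <= (1 - rho) / rho.
Proof. rewrite ler_pdivlMr // mul1r; move: rho_lt2; lra. Qed.

Lemma eta_gt0 : 0 < eta.
Proof.
have := log2_ge0 odds_ge1 => L; rewrite /eta divr_gt0 //.
by apply: mulr_gt0 => //; lra.
Qed.

Lemma eta_mul : eta * (log2 ((1 - rho) / rho) + 1) = rho / 4.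
Proof.
have := log2_ge0 odds_ge1 => L; rewrite /eta.
by field; apply/eqP; lra.
Qed.

Lemma eta_le : eta <= rho / 4.
Proof. by have := log2_ge0 odds_ge1; have := eta_mul; have := eta_gt0; nra. Qed.

Variable Y : {set colouring}.
Hypothesis Y_bal : Y \subset balanced_colourings adj E O rho.
Hypothesis Y_eq : forall chi v, chi \in Y -> v \notin F -> chi v = chi0 v.

Lemma leaf_forbidden chi v : chi \in Y -> v \in F -> chi v != m v.
Proof.
move=> chiY vF; have := subsetP Y_bal _ chiY; rewrite in_set => /andP[chiP _].
have [y vy] := exists_neighbour adj_reg d_gt0 v.
rewrite -(F_mono vF vy) -(Y_eq chiY); first exact: proper_colour_neq chiP vy.
by apply: contraL vy => yF; apply: F_indep.
Qed.

Lemma card_leaf : #|Y|%:R <= exp2 (#|F|%:R : R).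
Proof.
rewrite exp2_nat; apply: (@card_list_colourings R V F m chi0) => chi chiY.
by split=> v; [apply: Y_eq | apply: leaf_forbidden].
Qed.

Lemma balanced_side chi s : chi \in Y ->
  #|colour_class chi ord0 :&: side s|%:R
    <= #|colour_class chi ord0 :&: side (~~ s)|%:R + rho * #|V|%:R / 2.
Proof.
move/(subsetP Y_bal); rewrite inE => /andP[_]; rewrite -sideT -sideF ler_norml.
by case: s => /andP[/=]; lra.
Qed.

(* The zeros inside [A] number at most [(rho / 2 + eta) #|V|]; weighting each of
   them by x = rho / (1 - rho) gives the entropy bound, since
   (1 + x) x^-rho = exp2 (binary_entropy rho). *)
Lemma card_leaf_concentrated s c (A : {set V}) :
  A \subset F -> A \subset side s -> (forall a, a \in A -> m a = c) ->
  #|V|%:R - eta * #|V|%:R < #|A|%:R + #|NN A|%:R ->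
  #|Y|%:R <= exp2 (#|V|%:R / 2 * (1 - rho / 2)).
Proof.
move=> AF As Ac nearly.
have eta0 := eta_gt0; have eta1 := eta_le; have etaM := eta_mul.
have A_le : #|A|%:R <= #|V|%:R / 2 :> R.
  by rewrite -(card_sideR s) ler_nat subset_leq_card.
have NA_le : #|NN A|%:R <= #|V|%:R / 2 :> R.
  by rewrite -(card_sideR (~~ s)) ler_nat subset_leq_card // neighbourhood_side.
have F_le := card_leafR.
have n_ge0 : 0 <= (#|V|%:R : R) by [].
have n_gt0 : 0 < (#|V|%:R : R) by nra.
have NA_c chi y : chi \in Y -> y \in NN A -> chi y = c.
  move=> chiY /neighbourhoodP[a aA ay]; have aF := subsetP AF _ aA.
  rewrite (Y_eq chiY) ?(F_mono aF ay) ?Ac //.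
  by apply: contraL ay => yF; apply: F_indep.
have A_nc chi a : chi \in Y -> a \in A -> chi a != c.
  by move=> chiY aA; rewrite -(Ac a aA) leaf_forbidden // (subsetP AF).
have [->|/set0Pn[chi1 chi1Y]] := eqVneq Y set0.
  by rewrite cards0 ltW ?exp2_gt0.
(* If [c] were 0, colour 0 would fill almost all of the opposite side and be absent from [A],
   against the balance condition. *)
have c_neq0 : c != ord0.
  apply/eqP => c0; have := balanced_side (~~ s) chi1Y; rewrite negbK.
  have : #|NN A|%:R <= #|colour_class chi1 ord0 :&: side (~~ s)|%:R :> R.
    rewrite ler_nat subset_leq_card // subsetI neighbourhood_side // andbT.
    by apply/subsetP => y yA; rewrite inE (NA_c chi1) ?c0.
  have : #|A|%:R + #|colour_class chi1 ord0 :&: side s|%:R <= #|V|%:R / 2 :> R.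
    rewrite -(card_sideR s) -natrD ler_nat.
    rewrite -(cardsID (colour_class chi1 ord0) (side s)) addnC setIC leq_add2l.
    apply: subset_leq_card; apply/subsetP => a aA.
    by rewrite !inE -c0 (A_nc chi1 a) //; have := subsetP As _ aA; rewrite inE.
  by move: nearly rho_lt2; nra.
pose x : R := rho / (1 - rho).
have x_gt0 : 0 < x by rewrite divr_gt0 //; move: rho_lt2; lra.
pose L := log2 ((1 - rho) / rho).
have L_ge0 : 0 <= L := log2_ge0 odds_ge1.
have xE : x = exp2 (- L).
  by rewrite /L -log2V ?exp2_log2 ?invf_div //; move: odds_ge1; lra.
have x1E : 1 + x = exp2 (- log2 (1 - rho)).
  rewrite -log2V ?exp2_log2 ?invr_gt0; try (move: rho_lt2; lra).
  by rewrite /x; field; apply/eqP; move: rho_lt2; lra.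
pose k (chi : colouring) := #|[set a in A | chi a == ord0]|.
(* The opposite side has at most |V|/2 - |N(A)| < eta |V| zeros, and balance allows rho |V| / 2 more
   on this side. *)
have k_le chi : chi \in Y -> (k chi)%:R <= (rho + 2 * eta) * (#|V|%:R / 2).
  move=> chiY; have := balanced_side s chiY.
  have : (k chi)%:R <= #|colour_class chi ord0 :&: side s|%:R :> R.
    rewrite ler_nat subset_leq_card //; apply/subsetP => a.
    rewrite inE => /andP[aA a0]; have := subsetP As _ aA.
    by rewrite !inE a0.
  have : #|NN A|%:R + #|colour_class chi ord0 :&: side (~~ s)|%:R
           <= #|V|%:R / 2 :> R.
    rewrite -(card_sideR (~~ s)) -natrD ler_nat.
    rewrite -(cardsID (colour_class chi ord0) (side (~~ s))) addnC setIC leq_add2l.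
    apply: subset_leq_card; apply/subsetP => y yA.
    rewrite in_setD (subsetP (neighbourhood_side As)) // andbT.
    by rewrite inE (NA_c chi).
  by move: nearly; lra.
pose wt v (c' : 'I_3) : R := if (v \in A) && (c' == ord0) then x else 1.
have wt_ge0 v c' : 0 <= wt v c' by rewrite /wt; case: ifP => // _; apply: ltW.
have := @weighted_list_colourings R V F m chi0 wt Y wt_ge0.
(* A vertex of [A] may take 0 or one other colour, of total weight x + 1; any other free vertex has
   two colours of weight 1. *)
have -> : \prod_(v in F) \sum_(c' | c' != m v) wt v c'
          = (1 + x) ^+ #|A| * 2 ^+ #|F :\: A|.
  rewrite (big_setID A) /= (setIidPr AF) -!prodr_const; congr (_ * _).
    apply: eq_bigr => v vA; rewrite Ac // (bigD1 ord0) 1?eq_sym //=.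
    have one : #|[pred c' : 'I_3 | (c' != c) && (c' != ord0)]| = 1%N.
      have := card_neq_colour c; rewrite (cardD1 ord0) [_ \in _]inE eq_sym c_neq0.
      move=> /(@addnI 1%N _ 1%N); apply: etrans; apply: eq_card => c'; by rewrite !inE andbC.
    rewrite {1}/wt vA eqxx addrC (eq_bigr (fun=> 1)) ?sumr_const ?one //.
    by move=> c' /andP[_ /negbTE c'0]; rewrite /wt vA c'0.
  apply: eq_bigr => v; rewrite inE => /andP[/negbTE vA _].
  rewrite (eq_bigr (fun=> 1)) ?sumr_const ?card_neq_colour // => c' _.
  by rewrite /wt vA.
move=> bound; have {}bound := bound (fun chi chiY =>
  conj (fun v => @Y_eq chi v chiY) (fun v => @leaf_forbidden chi v chiY)).
have low chi : chi \in Y ->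
    exp2 (- L * ((rho + 2 * eta) * (#|V|%:R / 2))) <= \prod_(v in F) wt v (chi v).
  move=> chiY; have -> : \prod_(v in F) wt v (chi v) = x ^+ k chi.
    rewrite -prodr_const [LHS]big_mkcond [RHS]big_mkcond /=; apply: eq_bigr => v _.
    rewrite /wt inE; case: ifP => [vF //|vF]; case: ifP => // /andP[vA _].
    by rewrite (subsetP AF) in vF.
  rewrite xE -exp2Mn; apply: ler_exp2.
  by rewrite !mulNr lerN2 ler_wpM2l // k_le.
set z := - L * _ in low.
pose w := - log2 (1 - rho) * #|A|%:R + #|F :\: A|%:R.
have {bound} : #|Y|%:R * exp2 z <= exp2 w.
  rewrite exp2D exp2Mn exp2_nat -x1E mulr_natl -sumr_const.
  by apply: le_trans bound; apply: ler_sum.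
move=> H.
have {H} : #|Y|%:R <= exp2 (w - z).
  have := exp2_gt0 z => z0.
  by rewrite -(ler_pM2r z0) -exp2D subrK.
move/le_trans; apply; apply: ler_exp2; rewrite /w /z.
have -> : #|F :\: A|%:R = #|F|%:R - #|A|%:R :> R.
  by rewrite cardsD (setIidPr AF) natrB // subset_leq_card.
have Hl : binary_entropy rho = rho * L - log2 (1 - rho).
  rewrite /binary_entropy /L log2M ?log2V ?invr_gt0 //; first by ring.
  by move: rho_lt2; lra.
have l1 : log2 (1 - rho) <= 0 by apply: log2_le0; move: rho_gt0; lra.
move: H_rho; rewrite Hl; rewrite -/L in etaM.
(* The set [A] has at most |V|/2 vertices and misses at most eta |V| of [F]. The exponent is thus at
   most |V|/2 times the entropy, plus eta (L + 1) |V|. *)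
have b1 : - log2 (1 - rho) * #|A|%:R <= - log2 (1 - rho) * (#|V|%:R / 2).
  by rewrite ler_wpM2l // oppr_ge0.
have b2 : #|F|%:R - #|A|%:R <= eta * #|V|%:R by lra.
have b3 : (rho * L - log2 (1 - rho)) * (#|V|%:R / 2) <= (1 - rho) * (#|V|%:R / 2).
  by apply: ler_wpM2r; [rewrite divr_ge0 | move: H_rho; rewrite Hl; lra].
have b4 : eta * (L + 1) * #|V|%:R = rho / 4 * #|V|%:R by rewrite etaM.
by move=> _; lra.
Qed.

(** If all pieces are small, their gaps give 2 |F| <= |V| - delta |V| / 3. If one is not, and it
    leaves room r >= eta |V| beside itself and its neighbourhood, the gaps of the others save delta
    r / 3 in 2 |F|, whence eta / 6. Otherwise the entropy estimate saves rho |V| / 4, which is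
    more. *)
Lemma leaf_bound :
  #|Y|%:R <= exp2 (#|V|%:R / 2 - eta / 6 * delta * #|V|%:R).
Proof.
have eta0 := eta_gt0; have eta1 := eta_le; have F_le := card_leafR.
have n_ge0 : 0 <= (#|V|%:R : R) by [].
have gap i : small adj (piece i) ->
    delta * #|NN (piece i)|%:R + #|piece i|%:R <= #|NN (piece i)|%:R.
  exact: small_gap (piece_side i).
have total : #|F|%:R + \sum_i #|NN (piece i)|%:R <= #|V|%:R :> R.
  by rewrite -natr_sum -natrD ler_nat sum_card_neighbourhood_piece.
have FE : #|F|%:R = \sum_i #|piece i|%:R :> R by rewrite -natr_sum sum_card_piece.
(* If n >= r/3, the gap delta n suffices. Otherwise b <= n < r/3, and 2r/3 is below the bound
   because delta <= 1. *)
have half_gap (b n r : R) : 0 <= b -> 0 <= n -> delta * n + b <= n -> b + n <= r ->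
    2 * b <= r - delta * r / 3.
  move=> b0 n0 h1 h2; have dn := mulr_ge0 delta_ge0 n0.
  have [rn|nr] := lerP (r / 3) n; first by have := ler_wpM2l delta_ge0 rn; lra.
  have : 0 <= (1 - delta) * r by apply: mulr_ge0; move: delta_le1; lra.
  by lra.
have [/forallP small_all|] := boolP [forall i, small adj (piece i)].
  have h : delta * (\sum_i #|NN (piece i)|%:R) + #|F|%:R
             <= \sum_i #|NN (piece i)|%:R.
    by rewrite FE mulr_sumr -big_split /=; apply: ler_sum => i _; apply: gap.
  have := half_gap _ _ _ (ler0n _ _) (sumr_ge0 _ (fun i _ => ler0n _ _)) h total.
  move=> le2F; apply: le_trans card_leaf _; apply: ler_exp2.
  have : eta * (delta * #|V|%:R) <= delta * #|V|%:R.
    by rewrite ler_piMl ?mulr_ge0 //; move: rho_lt2; lra.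
  by lra.
rewrite negb_forall => /existsP[i0 big0].
rewrite (bigD1 i0) //= in total; rewrite (bigD1 i0) //= in FE.
set n' := \sum_(i | i != i0) #|NN (piece i)|%:R in total.
set b := \sum_(i | i != i0) _ in FE.
have gap' : delta * n' + b <= n'.
  rewrite mulr_sumr -big_split /=; apply: ler_sum => i ii0.
  exact/gap/other_piece_small/big0.
have b0 : 0 <= b by apply: sumr_ge0.
have n'0 : 0 <= n' by apply: sumr_ge0.
have le_piece : #|piece i0|%:R <= #|NN (piece i0)|%:R :> R.
  by rewrite ler_nat (leq_card_neighbourhood adj_sym adj_reg).
have [spread|conc] := lerP (#|piece i0|%:R + #|NN (piece i0)|%:R)
                           (#|V|%:R - eta * #|V|%:R).
  pose r : R := #|V|%:R - (#|piece i0|%:R + #|NN (piece i0)|%:R).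
  have le2b : 2 * b <= r - delta * r / 3.
    by apply: (half_gap _ n') => //; rewrite /r; lra.
  have r_ge : delta * (eta * #|V|%:R) <= delta * r.
    by rewrite ler_wpM2l // /r; lra.
  apply: le_trans card_leaf _; apply: ler_exp2.
  by rewrite /r in le2b r_ge; lra.
have := card_leaf_concentrated _ (piece_side i0) _ conc.
move=> /(_ i0.2 _ _)/le_trans; apply.
- by apply/subsetP => f; rewrite inE => /and3P[].
- by move=> a; rewrite inE => /and3P[_ _ /eqP].
apply: ler_exp2.
have : eta * (delta * #|V|%:R) <= rho / 4 * #|V|%:R.
  apply: ler_pM => //; first exact: ltW.
    by rewrite mulr_ge0.
  by rewrite ler_piMl.
by have := mulr_ge0 (ltW rho_gt0) n_ge0; lra.
Qed.

End Leaf.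

(** * Removing the edges inside the unresolved set *)

Lemma card_edge_colourings (c c' : 'I_3) :
  (#|[set p : 'I_3 * 'I_3 | [&& p.1 != c, p.2 != c' & p.1 != p.2]]| <= 3)%N.
Proof.
rewrite -sum1dep_card big_mkcond /= -(pair_bigA _ (fun a b : 'I_3 =>
  if [&& a != c, b != c' & a != b] then 1 else 0))%N /=.
(* Two lists of two colours out of three share a colour, so at most three of the four pairs are
   proper. *)
by case: c => [[|[|[|?]]] ?] //; case: c' => [[|[|[|?]]] ?] //;
  rewrite !big_ord_recl !big_ord0.
Qed.

(** Fifth powers: 243 <= 256. *)
Lemma exp2_ge3 : 3 <= exp2 (8 / 5 : R).
Proof.
rewrite -(@ler_pXn2r _ 5) ?nnegrE ?ltW ?exp2_gt0 // -exp2Mn.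
rewrite (_ : 8 / 5 * 5%:R = 8%:R); last by lra.
by rewrite exp2_nat; lra.
Qed.

Section Resolve.
Variable W : {set V}.
Hypothesis W_sparse : {in W, forall w, (10 * #|N w :&: W| < d)%N}.

(** The bound to be kept once [t] vertices of [W] are coloured. Two more vertices shrink it by
    exactly 2^(8/5). *)
Let B (t : R) : R :=
  exp2 (#|V|%:R / 2 - eta / 54 * delta * #|V|%:R - 4 / 5 * t).

Lemma exists_neighbour_out u : u \in W -> exists2 y, adj u y & y \notin W.
Proof.
move=> uW; have : (0 < #|N u :\: W|)%N.
  have := W_sparse uW; have := cardsID W (N u); rewrite adj_reg; lia.
case/card_gt0P => y; rewrite in_setD in_neighbours => /andP[yW uy].
by exists y.
Qed.

(** Neighbours of [W'] lie outside it, where all of [Y] agrees. A vertex of [W'] that sees two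
    colours is therefore determined, and the others form a set [F] as in the previous part.
    Sparseness of [W] bounds |F| by |V|/2 - 9t/10 with t = |W \ W'|. *)
Lemma resolve_independent (W' : {set V}) (Y : {set colouring}) :
  W' \subset W -> {in W' &, forall u v, ~~ adj u v} ->
  Y \subset balanced_colourings adj E O rho ->
  {in Y &, forall (chi chi' : colouring) v, v \notin W' -> chi v = chi' v} ->
  #|Y|%:R <= B #|W :\: W'|%:R.
Proof.
move=> W'W indep Ybal Yeq.
have [->|/set0Pn[chi1 chi1Y]] := eqVneq Y set0.
  by rewrite cards0 ltW ?exp2_gt0.
have proper chi : chi \in Y -> chi \in proper_colourings adj.
  by move/(subsetP Ybal); rewrite in_set => /andP[].
pose F := [set w in W' | [exists c, [forall y, adj w y ==> (chi1 y == c)]]].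
(* The default [ord0] never occurs, since every vertex has a neighbour. *)
pose m (v : V) := if [pick y | adj v y] is Some y then chi1 y else ord0.
have FW' : F \subset W' by apply/subsetP => f; rewrite inE => /andP[].
have F_indep : {in F &, forall u v, ~~ adj u v}.
  by move=> u v /(subsetP FW') uF /(subsetP FW') vF; apply: indep.
have F_mono f y : f \in F -> adj f y -> chi1 y = m f.
  rewrite inE => /andP[_ /existsP[c /forallP fc]] fy; rewrite /m.
  case: pickP => [z fz|/(_ y)]; last by rewrite fy.
  by rewrite (eqP (implyP (fc y) fy)) (eqP (implyP (fc z) fz)).
have Y_eq chi v : chi \in Y -> v \notin F -> chi v = chi1 v.
  move=> chiY; have [vW'|vW' _] := boolP (v \in W'); last exact: Yeq.
  rewrite inE vW' /= negb_exists => /forallP vc.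
  have [y1 vy1] := exists_neighbour adj_reg d_gt0 v.
  have := vc (chi1 y1); rewrite negb_forall => /existsP[y2].
  rewrite negb_imply => /andP[vy2 y12].
  have out y : adj v y -> y \notin W' by apply: contraL; apply: indep.
  apply/eqP/contraT => neq.
  have avoid y : adj v y -> (chi1 y != chi v) && (chi1 y != chi1 v).
    move=> vy; rewrite ![chi1 y == _]eq_sym -{1}(Yeq chi chi1 chiY chi1Y) ?out //.
    have n1 := proper_colour_neq (proper _ chi1Y) vy.
    by rewrite (proper_colour_neq (proper _ chiY) vy) n1.
  (* Two distinct neighbour colours and two distinct candidates for [v] would make four colours. *)
  have : [set chi1 y2; chi1 y1] \subset ~: [set chi v; chi1 v].
    by apply/subsetP => c; rewrite !inE negb_or => /orP[] /eqP->; apply: avoid.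
  by move/card_avoiding; rewrite !cards2 y12 neq.
have cover := sparse_cover_bound adj_sym adj_reg d_gt0 (subsetDl W W').
have {}cover : (10 * #|W| <= 5 * #|V| + #|W :\: W'|)%N.
  apply: cover => [u v|w wW]; last exact/ltnW/W_sparse.
  by rewrite setDDr setDv set0U (setIidPr W'W); apply: indep.
have {}cover : 10 * #|W'|%:R <= 5 * #|V|%:R - 9 * #|W :\: W'|%:R :> R.
  have : (10 * #|W'| + 9 * #|W :\: W'| <= 5 * #|V|)%N.
    by have := cardsID W' W; rewrite (setIidPr W'W); lia.
  by rewrite -(ler_nat R) natrD !natrM; lra.
have F_le : #|F|%:R <= #|W'|%:R :> R by rewrite ler_nat subset_leq_card.
have eta0 := eta_gt0.
(* At this threshold both estimates equal the bound [B]: t/10 is then eta delta |V| / 54, and 4t/5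
   makes up the difference between eta/6 and eta/54. *)
have [many|few] := lerP (10 / 9 * (eta / 6 * delta * #|V|%:R)) #|W :\: W'|%:R.
  apply: le_trans (card_leaf F_indep F_mono Ybal Y_eq) _; apply: ler_exp2.
  by lra.
apply: le_trans (leaf_bound F_indep F_mono Ybal Y_eq) _; apply: ler_exp2.
by lra.
Qed.

(* The two ends of an edge inside [W'] have at most 3 < 2^(8/5) joint colours. *)
Lemma resolve_bound (W' : {set V}) (Y : {set colouring}) :
  W' \subset W ->
  Y \subset balanced_colourings adj E O rho ->
  {in Y &, forall (chi chi' : colouring) v, v \notin W' -> chi v = chi' v} ->
  #|Y|%:R <= B #|W :\: W'|%:R.
Proof.
have [n] := ubnP #|W'|; elim: n => // n IH in W' Y *.
rewrite ltnS => W'n W'W Ybal Yeq.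
have [/exists_inP[u uW' /exists_inP[w wW' uw]]|noedge] :=
    boolP [exists u in W', exists w in W', adj u w]; last first.
  apply: resolve_independent => // u w uW' wW'; apply: contraNN noedge => uw.
  by apply/exists_inP; exists u => //; apply/exists_inP; exists w.
have [->|/set0Pn[chi1 chi1Y]] := eqVneq Y set0.
  by rewrite cards0 ltW ?exp2_gt0.
have proper chi : chi \in Y -> chi \in proper_colourings adj.
  by move/(subsetP Ybal); rewrite in_set => /andP[].
have neq_uw : u != w.
  by have := proper_colour_neq (proper _ chi1Y) uw; apply: contraNneq => ->.
(* Outside [W] the colours are common to all of [Y], so [a] and [b] forbid one fixed colour at each
   end of the edge. *)
have [a ua aW] := exists_neighbour_out (subsetP W'W _ uW').
have [b wb bW] := exists_neighbour_out (subsetP W'W _ wW').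
have out y : y \notin W -> y \notin W' by apply: contraNN; apply: (subsetP W'W).
pose P := [set p : 'I_3 * 'I_3 |
  [&& p.1 != chi1 a, p.2 != chi1 b & p.1 != p.2]].
pose Yp (p : 'I_3 * 'I_3) := [set chi in Y | (chi u, chi w) == p].
have -> : #|Y|%:R = \sum_(p in P) #|Yp p|%:R :> R.
  rewrite -natr_sum; congr _%:R.
  rewrite -sum1_card (partition_big (fun chi : colouring => (chi u, chi w)) (mem P)).
    by apply: eq_bigr => p _; rewrite sum1dep_card.
  move=> chi chiY; rewrite inE in_set /=.
  rewrite -(Yeq chi chi1 chiY chi1Y a (out a aW)) -(Yeq chi chi1 chiY chi1Y b (out b bW)).
  have ne := proper_colour_neq (proper _ chiY).
  by rewrite (ne _ _ ua) (ne _ _ wb) (ne _ _ uw).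
pose W2 := W' :\: [set u; w].
have W2W' : W2 \subset W' := subsetDl _ _.
have uwW' : [set u; w] \subset W'.
  by apply/subsetP => v; rewrite in_set2 => /orP[] /eqP->.
have cW2 : (#|W'| = 2 + #|W2|)%N.
  by rewrite -(cardsID [set u; w] W') (setIidPr uwW') cards2 neq_uw.
have cT : (#|W :\: W2| = 2 + #|W :\: W'|)%N.
  apply/eqP; rewrite -(eqn_add2l #|W2|).
  have := cardsID W2 W; rewrite (setIidPr (subset_trans W2W' W'W)) => ->.
  by rewrite addnCA addnA -cW2 -(cardsID W' W) (setIidPr W'W).
have bound p : #|Yp p|%:R <= B (2 + #|W :\: W'|%:R).
  rewrite -natrD -cT; apply: IH.
  - by apply: leq_trans W'n; rewrite cW2 -add1n leq_add2r.
  - exact: subset_trans W2W' W'W.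
  - by apply: subset_trans Ybal; apply/subsetP => chi; rewrite inE => /andP[].
  move=> chi chi'; rewrite !inE => /andP[chiY /eqP e] /andP[chi'Y /eqP e'] v.
  rewrite !inE negb_and negbK => /orP[/orP[]/eqP->|]; last exact: Yeq.
    by rewrite [LHS](congr1 fst e) [RHS](congr1 fst e').
  by rewrite [LHS](congr1 snd e) [RHS](congr1 snd e').
apply: (@le_trans _ _ (\sum_(p in P) B (2 + #|W :\: W'|%:R))).
  by apply: ler_sum => p _; apply: bound.
rewrite sumr_const -[_ *+ #|P|]mulr_natl.
apply: (@le_trans _ _ (exp2 (8 / 5) * B (2 + #|W :\: W'|%:R))).
  apply: ler_wpM2r; first exact/ltW/exp2_gt0.
  apply: le_trans exp2_ge3.
  by rewrite ler_nat card_edge_colourings.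
by rewrite /B -exp2D ler_exp2 //; lra.
Qed.

End Resolve.

(** * Summation over the revealed partial colourings *)

Lemma saturated_bound (g : {ffun V -> option 'I_3}) :
  #|[set chi in balanced_colourings adj E O rho |
       extends chi g && saturated adj d chi g]|%:R
    <= exp2 (#|V|%:R / 2 - eta / 54 * delta * #|V|%:R).
Proof.
set Y := [set chi in _ | _].
have sparse : {in unresolved adj d g, forall w,
    (10 * #|N w :&: unresolved adj d g| < d)%N}.
  move=> w; rewrite inE => /andP[_]; apply: leq_ltn_trans.
  rewrite leq_mul2l subset_leq_card ?orbT // setIS //.
  by apply/subsetP => v; rewrite inE => /andP[].
(* The recursion starts with all of [W] uncoloured, that is at t = 0. *)
have := @resolve_bound _ sparse _ Y (subxx _).
rewrite setDv cards0 mulr0 subr0; apply.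
  by apply/subsetP => chi; rewrite inE => /andP[].
have unpack chi : chi \in Y -> [/\ chi \in proper_colourings adj,
    extends chi g & saturated adj d chi g].
  by rewrite in_set => /andP[]; rewrite in_set => /andP[-> _] /andP[-> ->].
move=> chi chi' /unpack[P1 E1 S1] /unpack[P2 E2 S2] v.
exact: eq_off_unresolved.
Qed.

(** Weighting each revealed vertex by 1/d, every [g] counted weighs at least d^(-K |V| / d), while
    the total weight (1 + 3/d)^|V| is at most 2^(6 |V| / d). *)
Lemma card_small_support (K : R) : 0 <= K ->
  #|[set g : {ffun V -> option 'I_3} |
      d%:R * #|[set v | g v]|%:R <= K * #|V|%:R]|%:R
    <= exp2 ((K * log2 d%:R + 6) * (#|V|%:R / d%:R)).
Proof.
move=> K0; set G := [set g | _].
have d1 : 1 <= (d%:R : R) by rewrite ler1n.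
have d0 : 0 < (d%:R : R) by rewrite ltr0n.
have ld := log2_ge0 d1.
have dV : (d%:R : R)^-1 = exp2 (- log2 d%:R).
  by rewrite -log2V // exp2_log2 // invr_gt0.
pose z : R := - log2 d%:R * (K * (#|V|%:R / d%:R)).
have low : #|G|%:R * exp2 z <= (1 + 3 * d%:R^-1) ^+ #|V|.
  rewrite -weighted_partial_colourings mulr_natl -sumr_const.
  rewrite [leRHS](bigID (mem G)) /= ler_wpDr //.
    by apply: sumr_ge0 => g _; rewrite exprn_ge0 // invr_ge0.
  apply: ler_sum => g; rewrite inE => gG.
  rewrite dV -exp2Mn ler_exp2 // /z !mulNr lerN2 ler_wpM2l //.
  by rewrite mulrA ler_pdivlMr // mulrC.
have up : (1 + 3 * d%:R^-1) ^+ #|V| <= exp2 (6 * (#|V|%:R / d%:R) : R).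
  rewrite (_ : 6 * _ = 2 * (3 * d%:R^-1) * #|V|%:R); last by field; apply/eqP; lra.
  have V0 : 0 <= 3 * (d%:R : R)^-1 by rewrite mulr_ge0 // invr_ge0.
  by rewrite exp2Mn lerXn2r ?nnegrE ?exp2_ge1D ?addr_ge0 // ltW ?exp2_gt0.
rewrite -(ler_pM2r (exp2_gt0 z)) -exp2D.
by apply: le_trans low (le_trans up _); apply: ler_exp2; rewrite /z; lra.
Qed.

Lemma card_balanced_le :
  #|balanced_colourings adj E O rho|%:R
    <= exp2 ((40 * log2 d%:R + 6) * (#|V|%:R / d%:R)
             + (#|V|%:R / 2 - eta / 54 * delta * #|V|%:R)).
Proof.
pose G := [set g : {ffun V -> option 'I_3} |
  d%:R * #|[set v | g v]|%:R <= 40 * (#|V|%:R : R)].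
pose Yg g := [set chi in balanced_colourings adj E O rho |
       extends chi g && saturated adj d chi g].
have cover : balanced_colourings adj E O rho \subset \bigcup_(g in G) Yg g.
  apply/subsetP => chi chiB; have := chiB; rewrite in_set => /andP[chiP _].
  have [g [ext sat supp]] := exists_saturated adj_sym d_gt0 chiP.
  apply/bigcupP; exists g; first by rewrite inE -!natrM ler_nat.
  by rewrite in_set chiB ext sat.
rewrite exp2D.
apply: (@le_trans _ _ (\sum_(g in G) #|Yg g|%:R)).
  rewrite -natr_sum ler_nat; apply: leq_trans (subset_leq_card cover) _.
  exact: leq_card_bigcup.
apply: (@le_trans _ _ (\sum_(g in G)
    exp2 (#|V|%:R / 2 - eta / 54 * delta * #|V|%:R))).
  by apply: ler_sum => g _; apply: saturated_bound.
rewrite sumr_const -[_ *+ #|G|]mulr_natl; apply: ler_wpM2r; first exact/ltW/exp2_gt0.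
exact: (@card_small_support 40).
Qed.

End Expansion.

(** * Choice of constants and conclusion *)

Unset Implicit Arguments.

Theorem theorem1p8 (R : realType) (rho : R)
    (rho_gt0 : 0 < rho) (rho_le1 : rho <= 1)
    (H_rho : binary_entropy rho + rho < 1) :
  exists d0 C1 C1' C2 : R,
    [/\ 0 < d0, 0 < C1, 0 < C1' & 0 < C2] /\
    forall (V : finType) (adj : rel V) (E O : {set V}) (d N l : nat) (delta : R),
      simple_graph adj ->
      bipartition adj E O ->
      regular adj d ->
      #|V| = N ->
      is_bipartite_expansion adj E O delta ->
      is_locality adj d l ->
      (0 < l)%N ->
      delta >= Num.max (C1 * log2 d%:R ^+ 3 / d%:R) (C1' * log2 d%:R / l%:R) ->
      d%:R >= d0 ->
      #|balanced_colourings adj E O rho|%:R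
        <= exp2 (N%:R / 2 * (1 - C2 * delta / log2 d%:R)).
Proof.
have rho_lt2 := binary_entropy_lt_half rho_gt0 rho_le1 H_rho.
have eta0 : 0 < eta rho by apply: eta_gt0.
(* From d >= 2 one gets log d >= 1, so revealing costs at most 46 = 40 + 6 times |V| log d / d, and
   log d is at most its cube. As 4968 = 46 * 108, this is at most half of the saving eta delta |V| /
   54; the other half is |V|/2 times eta delta / 54. *)
exists 2, (4968 / eta rho), 1, (eta rho / 54); split.
  by split=> //; rewrite divr_gt0.
move=> V adj E O d N l delta [adj_sym _] EO_bip adj_reg <- [[A [_ _ A0 deltaE]] expansion].
move=> _ _; rewrite ge_max => /andP[delta_ge _] d_ge2.
have d_gt0 : (0 < d)%N by rewrite -(ltr0n R) (lt_le_trans _ d_ge2).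
have d0 : 0 < (d%:R : R) by rewrite ltr0n.
have log_ge1 := log2_ge1 d_ge2.
set lam := log2 d%:R in delta_ge log_ge1 *.
(* The minimum is attained at the nonempty set [A], whose neighbourhood is nonempty, so the ratio is
   a genuine quotient. *)
have delta_le1 : delta <= 1.
  have NA0 : 0 < (#|neighbourhood adj A|%:R : R).
    rewrite ltr0n; apply: leq_trans (leq_card_neighbourhood adj_sym adj_reg d_gt0 A).
    by rewrite card_gt0.
  by rewrite deltaE /expansion_ratio ler_pdivrMr // mul1r gerBl.
have lam3 : lam <= lam ^+ 3 by apply: ler_eXnr.
have cost : 46 * (lam / d%:R) <= eta rho / 108 * delta.
  have : 4968 / eta rho * (lam / d%:R) <= delta.
    apply: le_trans delta_ge; rewrite -[leRHS]mulrA.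
    apply: ler_wpM2l; first by rewrite divr_ge0 // ltW.
    by rewrite ler_pM2r ?invr_gt0.
  move=> /(ler_wpM2l (ltW eta0)).
  have -> : eta rho * (4968 / eta rho * (lam / d%:R)) = 4968 * (lam / d%:R).
    by field; rewrite !gt_eqF.
  by lra.
have delta_ge0 : 0 <= delta.
  have : 0 <= 46 * (lam / d%:R) by rewrite mulr_ge0 // divr_ge0 //; lra.
  by move=> /le_trans/(_ cost); rewrite pmulr_rge0 // divr_gt0.
apply: le_trans (card_balanced_le adj_sym adj_reg d_gt0 EO_bip rho_gt0 rho_lt2
  H_rho delta_ge0 delta_le1 expansion) _.
apply: ler_exp2; rewrite -/lam.
have V0 : 0 <= (#|V|%:R : R) by [].
have h1 : (40 * lam + 6) * (#|V|%:R / d%:R) <= eta rho / 108 * delta * #|V|%:R.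
  apply: (@le_trans _ _ (46 * (lam / d%:R) * #|V|%:R)); last exact: ler_wpM2r.
  rewrite (_ : 46 * (lam / d%:R) * #|V|%:R = 46 * lam * (#|V|%:R / d%:R)); last by ring.
  by apply: ler_wpM2r; [rewrite divr_ge0 | lra].
have h2 : eta rho / 54 * delta / lam <= eta rho / 54 * delta.
  rewrite ler_pdivrMr; last by lra.
  by rewrite ler_peMr // mulr_ge0 // divr_ge0 // ltW.
have := ler_wpM2r V0 h2; lra.
Qed.
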